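(* Let $a<b$, let $\kappa,\eta,\nu,\sigma$ be real constants with $\kappa>0$, and let $W=\{W(t)\}_{t\ge 0}$ be a scalar Brownian motion with formal time derivative $\dot W$ (Gaussian white noise). Let $f:[a,b]\to\mathbb{R}$ be given, let $a_1,a_2,b_1,b_2,c_1,c_2,d_1,d_2$ be constants, and let $g_1,g_2,g_3,g_4$ be deterministic or stochastic functions of $t\in(0,\infty)$. Consider the initial boundary value problem (S) for the stochastic generalized Kuramoto--Sivashinsky equation $$\frac{\partial u}{\partial t}=-u\frac{\partial u}{\partial x}-\kappa\frac{\partial^2 u}{\partial x^2}-\eta\frac{\partial^3 u}{\partial x^3}-\nu\frac{\partial^4 u}{\partial x^4}+\sigma\dot W(t),\qquad x\in(a,b),\ t\in(0,\infty),$$ with initial condition $u(x,0)=f(x)$ for $x\in[a,b]$ and boundary conditions, for $t\in(0,\infty)$, $$a_1u(a,t)+a_2u_x(a,t)=g_1(t),\qquad b_1u(b,t)+b_2u_x(b,t)=g_2(t),$$ $$c_1u(a,t)+c_2u_x(a,t)=g_3(t),\qquad d_1u(b,t)+d_2u_x(b,t)=g_4(t).$$ Define $$X(x,t)=x-\sigma\int_0^t W(s)\,ds .$$ Then the solution of (S) is given by $$u(x,t)=v\!\left(x-\sigma\int_0^t W(s)\,ds,\;t\right)+\sigma W(t),$$ where $v=v(\chi,t)$ is the solution of the following problem (D): the generalized Kuramoto--Sivashinsky equation $$\frac{\partial v}{\partial t}=-v\frac{\partial v}{\partial \chi}-\kappa\frac{\partial^2 v}{\partial \chi^2}-\eta\frac{\partial^3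 v}{\partial \chi^3}-\nu\frac{\partial^4 v}{\partial \chi^4},\qquad \chi\in(X(a,t),X(b,t)),\ t\in(0,\infty),$$ with initial condition $v(\chi,0)=f(\chi)$ for $\chi\in[X(a,0),X(b,0)]=[a,b]$ and boundary conditions, for $t\in(0,\infty)$, $$a_1v(X(a,t),t)+a_2v_\chi(X(a,t),t)=g_1(t)-a_1\sigma W(t),$$ $$b_1v(X(b,t),t)+b_2v_\chi(X(b,t),t)=g_2(t)-b_1\sigma W(t),$$ $$c_1v(X(a,t),t)+c_2v_\chi(X(a,t),t)=g_3(t)-c_1\sigma W(t),$$ $$d_1v(X(b,t),t)+d_2v_\chi(X(b,t),t)=g_4(t)-d_1\sigma W(t).$$ That is, if $v$ solves (D), then the function $u$ defined by $u(x,t)=v\!\left(x-\sigma\int_0^t W(s)\,ds,\;t\right)+\sigma W(t)$ solves (S).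
   Context: Brownian motion $W$ has continuous paths and $W(0)=0$. Subscripts $x$ and $\chi$ denote partial derivatives in the spatial variable. Solutions are understood path by path (for each realization of $W$) and in the classical sense: $v$ is continuously differentiable in $t$ and four times continuously differentiable in $\chi$ on $\{(\chi,t): t>0,\ X(a,t)<\chi<X(b,t)\}$, with $v$ and $v_\chi$ extending continuously to the lateral boundary for $t>0$ and $v$ continuous up to $t=0$; similarly for $u$ in its spatial variable. Because the forcing $\sigma\dot W(t)$ is white noise with constant amplitude $\sigma$, the stochastic equation is understood in the time-integrated sense, equivalently as the statement that for each $x\in(a,b)$ the function $t\mapsto u(x,t)-\sigma W(t)$ is differentiable for $t>0$ with derivative $-u u_x-\kappa u_{xx}-\eta u_{xxx}-\nu u_{xxxx}$ evaluated at $(x,t)$. *)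

(* Defs.v *)
From mathcomp Require Import all_boot all_order all_algebra.
From mathcomp Require Import all_classical all_reals all_analysis.

Set Implicit Arguments.
Unset Strict Implicit.
Unset Printing Implicit Defensive.

Import Order.TTheory GRing.Theory Num.Theory.
Import numFieldNormedType.Exports.

Local Open Scope classical_set_scope.
Local Open Scope ring_scope.

(* Standard scalar Brownian motion, on the time set [0, +oo[: values of [W] at
   negative times are irrelevant.  Every path (not just almost every one)
   starts at 0 and is continuous. *)
Definition brownian_motion {R : realType} {d : measure_display}
    {T : measurableType d} (P : probability T R) (W : R -> {RV P >-> R}) : Prop :=
  [/\ forall w : T, W 0 w = 0,
      forall w : T, {within [set t : R | 0 <= t], continuous (fun t => W t w)},
      (* the second parameter of [normal_prob] is the standard deviation *)
      forall (s t : R) (A : set R), 0 <= s -> s < t -> measurable A ->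
        P [set w | A (W t w - W s w)] = normal_prob 0 (Num.sqrt (t - s)) A
    & forall (n : nat) (t : nat -> R) (A : nat -> set R),
        0 <= t 0%N -> {homo t : i j / (i <= j)%N >-> i <= j} ->
        (forall i, measurable (A i)) ->
        P [set w | forall i, (i < n)%N -> A i (W (t i.+1) w - W (t i) w)] =
        (\prod_(i < n) P [set w | A i (W (t i.+1) w - W (t i) w)%R])%E].

Section Problems.
Context {R : realType}.

(* [l] and [r] are the left and right lateral curves of a space-time domain;
   a point of space-time is [p = (position, time)]. *)
Definition open_domain (l r : R -> R) : set (R * R) :=
  [set p | 0 < p.2 /\ l p.2 < p.1 < r p.2].

Definition lateral_domain (l r : R -> R) : set (R * R) :=
  [set p | 0 < p.2 /\ l p.2 <= p.1 <= r p.2].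

Definition closed_domain (l r : R -> R) : set (R * R) :=
  [set p | 0 <= p.2 /\ l p.2 <= p.1 <= r p.2].

Definition dspace (k : nat) (u : R -> R -> R) (x t : R) : R :=
  (fun y : R => u y t)^`(k)%classic x.

Definition C4_space (D : set (R * R)) (u : R -> R -> R) : Prop :=
  (forall (k : nat) (p : R * R), (k < 4)%N -> D p ->
     derivable (fun y : R => dspace k u y p.2) p.1 1) /\
  (forall k : nat, (k <= 4)%N ->
     {in D, continuous (fun p : R * R => dspace k u p.1 p.2)}).

Definition C1_time (D : set (R * R)) (u : R -> R -> R) : Prop :=
  (forall p : R * R, D p -> derivable (u p.1) p.2 1) /\
  {in D, continuous (fun p : R * R => (u p.1)^`()%classic p.2)}.

(* [ux] is the continuous extension of the first spatial derivative of [u] to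
   the lateral boundary; as [l < r] it is determined by [u] there. *)
Definition lateral_extension (l r : R -> R) (u ux : R -> R -> R) : Prop :=
  (forall p : R * R, open_domain l r p -> ux p.1 p.2 = dspace 1 u p.1 p.2) /\
  {within lateral_domain l r, continuous (fun p : R * R => ux p.1 p.2)}.

Definition gks_rhs (kappa eta nu : R) (u : R -> R -> R) (x t : R) : R :=
  - (u x t * dspace 1 u x t) - kappa * dspace 2 u x t
  - eta * dspace 3 u x t - nu * dspace 4 u x t.

(* Classical solution [u] of the forced problem on ]a, b[ driven by one path
   [w] of the Brownian motion; the white noise is understood in the
   time-integrated sense, i.e. it is [u - sigma w] that is differentiated. *)
Definition solves_S (a b kappa eta nu sigma : R) (w f : R -> R)
    (a1 a2 b1 b2 c1 c2 d1 d2 : R) (g1 g2 g3 g4 : R -> R)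
    (u : R -> R -> R) : Prop :=
  let l := fun=> a in
  let r := fun=> b in
  [/\ C4_space (open_domain l r) u,
      {within closed_domain l r, continuous (fun p : R * R => u p.1 p.2)},
      forall x t : R, a < x < b -> 0 < t ->
        is_derive t 1 (fun s : R => u x s - sigma * w s)
          (gks_rhs kappa eta nu u x t),
      forall x : R, a <= x <= b -> u x 0 = f x
    & exists2 ux : R -> R -> R, lateral_extension l r u ux &
        forall t : R, 0 < t ->
          [/\ a1 * u a t + a2 * ux a t = g1 t,
              b1 * u b t + b2 * ux b t = g2 t,
              c1 * u a t + c2 * ux a t = g3 t
            & d1 * u b t + d2 * ux b t = g4 t]].

Definition frame (sigma : R) (w : R -> R) (x t : R) : R :=
  x - sigma * \int[lebesgue_measure]_(s in `[0, t]) w s.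

Definition solves_D (a b kappa eta nu sigma : R) (w f : R -> R)
    (a1 a2 b1 b2 c1 c2 d1 d2 : R) (g1 g2 g3 g4 : R -> R)
    (v : R -> R -> R) : Prop :=
  let Xa := frame sigma w a in
  let Xb := frame sigma w b in
  [/\ C4_space (open_domain Xa Xb) v /\ C1_time (open_domain Xa Xb) v,
      {within closed_domain Xa Xb, continuous (fun p : R * R => v p.1 p.2)},
      forall chi t : R, Xa t < chi < Xb t -> 0 < t ->
        (v chi)^`()%classic t = gks_rhs kappa eta nu v chi t,
      forall chi : R, Xa 0 <= chi <= Xb 0 -> v chi 0 = f chi
    & exists2 vchi : R -> R -> R, lateral_extension Xa Xb v vchi &
        forall t : R, 0 < t ->
          [/\ a1 * v (Xa t) t + a2 * vchi (Xa t) t = g1 t - a1 * sigma * w t,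
              b1 * v (Xb t) t + b2 * vchi (Xb t) t = g2 t - b1 * sigma * w t,
              c1 * v (Xa t) t + c2 * vchi (Xa t) t = g3 t - c1 * sigma * w t
            & d1 * v (Xb t) t + d2 * vchi (Xb t) t = g4 t - d1 * sigma * w t]].

End Problems.

(* Main.v *)
Require Import Defs.
From mathcomp Require Import all_boot all_order all_algebra.
From mathcomp Require Import all_classical all_reals all_analysis.
From mathcomp Require Import ring lra.
Import Order.TTheory GRing.Theory Num.Theory.
Import numFieldNormedType.Exports.
Local Open Scope classical_set_scope.
Local Open Scope ring_scope.

(** The noise is a force constant in space, so it is removed by passing to the
accelerated frame: with c(t) = sigma * int_0^t w, the velocity sigma * w(t)
added to v is the velocity c'(t) at which the frame moves.  The argument
is made for each path w of the Brownian motion: continuity of w makes c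
differentiable, and w(0) = 0 makes the two initial conditions agree.

At fixed time, u is v translated in space plus a constant, so the two have the
same spatial derivatives of every positive order, at corresponding points
([derive1n_translate]).  In time, u(x, s) - sigma * w(s) = v(x - c(s), s), the
noise term cancelling exactly.  The chain rule along s |-> (x - c(s), s)
([is_derive_along_curve]) and c'(t) = sigma * w(t), which is the fundamental
theorem of calculus ([is_derive_primitive]), give its derivative as
v_t - sigma * w(t) * v_chi.  The extra transport term is absorbed by the
nonlinearity, since u * u_x = (v + sigma * w) * v_chi; this is why the frame has
to move at exactly this speed.

The continuity requirements are transported by the map
(x, t) |-> (x - c(t), t), which is continuous and sends each of the fixed
space-time domains into the corresponding moving one. *)

(** * Continuity relative to a set *)

(** Up to the boundary [f] is only continuous relative to [B], so [g] has to
approach its limits from inside [B]. *)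
Lemma within_continuous_comp_into {X Y Z : topologicalType} (A : set X)
    (B : set Y) (g : X -> Y) (f : Y -> Z) :
  (forall x, A x -> B (g x)) -> {within A, continuous g} ->
  {within B, continuous f} -> {within A, continuous (f \o g)}.
Proof.
move=> gAB /subspace_continuousP cg /subspace_continuousP cf.
apply/subspace_continuousP => x Ax; apply: cvg_comp; last exact: cf (gAB _ Ax).
move=> U nU; have nU' : nbhs (g x) [set y | B y -> U y] by exact: nU.
have nH : nbhs x [set y | A y -> B (g y) -> U (g y)] by exact: (cg x Ax _ nU').
suff : nbhs x [set y | A y -> U (g y)] by [].
by apply: filterS nH => y h Ay; exact: h (gAB _ Ay).
Qed.

(** * The displacement of the frame *)

Section Path.
Context {R : realType}.
Variable w : R -> R.
Hypothesis cw : {within [set t : R | 0 <= t], continuous w}.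

Lemma path_continuous_at (t : R) : 0 < t -> {for t, continuous w}.
Proof.
move=> t0; apply: (@within_continuous_continuous _ _ _ 0 (t + 1)).
- lra.
- by apply: continuous_subspaceW cw => x /=; rewrite in_itv/= => /andP[].
- by rewrite in_itv/=; lra.
Qed.

Lemma path_integrable (t : R) :
  lebesgue_measure.-integrable `[0, t] (EFin \o w).
Proof.
apply: continuous_compact_integrable; first exact: segment_compact.
by apply: continuous_subspaceW cw => x /=; rewrite in_itv/= => /andP[].
Qed.

Lemma is_derive_primitive (t : R) : 0 < t ->
  is_derive t 1 (fun t : R => \int[lebesgue_measure]_(s in `[0, t]) w s) (w t).
Proof.
move=> t0.
have [] := @continuous_FTC1_closed R w 0 t (t + 1) _ (path_integrable _) t0
  (path_continuous_at t t0); first by lra.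
by move=> dF; rewrite derive1E => Fw; exact: DeriveDef.
Qed.

(** Continuity is needed also at the initial time, where there is no derivative:
to the left of 0 the integral is over the empty set, and at 0 absolute
continuity of the integral applies. *)
Lemma continuous_primitive :
  continuous (fun t : R => \int[lebesgue_measure]_(s in `[0, t]) w s).
Proof.
move=> t; have [t0|t0|->] := ltgtP t 0.
- rewrite /continuous_at [X in _ --> X](_ : _ = 0); last first.
    by rewrite set_itv_ge ?Rintegral_set0// bnd_simp -ltNge.
  apply: cvg_near_cst; near=> s.
  rewrite set_itv_ge ?Rintegral_set0// bnd_simp -ltNge.
  by near: s; exact: lt_nbhsl.
- apply: differentiable_continuous; apply/derivable1_diffP.
  by have [] := is_derive_primitive t t0.
- rewrite /continuous_at set_itv1 Rintegral_set1.
  exact: (@parameterized_integral_cvg_left R 0 1 w ltr01 (path_integrable _)).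
Unshelve. all: by end_near. Qed.

End Path.

(** * Spatial derivatives of translates *)

Section Translation.
Context {R : realType}.
Implicit Types (f : R -> R) (c h x : R).

Lemma diff_quotient_translate f c h x :
  (fun e : R => e^-1 *: ((fun y => f (y - c) + h) (e + x) -
     (fun y => f (y - c) + h) x)) =
  (fun e : R => e^-1 *: (f (e + (x - c)) - f (x - c))).
Proof. by apply/funext => e; rewrite addrA opprD addrACA subrr addr0. Qed.

(** As [derive1] is the limit of the difference quotient whether or not that
limit exists, no differentiability is required. *)
Lemma derive1_translate f c h :
  (fun y => f (y - c) + h)^`()%classic = (fun y => f^`()%classic (y - c)).
Proof. by apply/funext => x; rewrite /derive1 diff_quotient_translate. Qed.

Lemma derivable_translate f c h x :
  derivable f (x - c) 1 -> derivable (fun y => f (y - c) + h) x 1.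
Proof.
move=> df; apply: derivableD; last exact: derivable_cst.
apply/derivable1_diffP.
apply: (@differentiable_comp _ _ _ _ (fun y => y - c) f).
  by apply/derivable1_diffP; apply: derivableB.
exact/derivable1_diffP.
Qed.

Lemma derive1n_translate f c h k :
  (fun y => f (y - c) + h)^`(k.+1)%classic =
  (fun y => f^`(k.+1)%classic (y - c)).
Proof.
elim: k => [|k IHk]; first exact: derive1_translate.
rewrite /derive1n iterS -/(derive1n _ _) IHk.
rewrite (_ : (fun y => _) = (fun y => f^`(k.+1)%classic (y - c) + 0)).
  by rewrite derive1_translate.
by apply/funext => y; rewrite addr0.
Qed.

End Translation.

(** * Differentiation along a moving point *)

(** A mean value theorem for increments of either sign, as the two-sided limit
of difference quotients demands. *)
Lemma mean_value_near {R : realType} (f : R -> R) (t h : R) :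
  (forall s, `|s - t| <= `|h| -> derivable f s 1) ->
  exists2 s, `|s - t| <= `|h| & f (h + t) - f t = f^`()%classic s * h.
Proof.
move=> df.
have H (a b : R) : a <= b -> (forall s, a <= s <= b -> derivable f s 1) ->
    exists2 s, a <= s <= b & f b - f a = f^`()%classic s * (b - a).
  move=> ab dab.
  have dab' s : s \in `[a, b] -> derivable f s 1 by rewrite in_itv/= => /dab.
  have [||s] := @MVT_segment R f f^`()%classic a b ab.
  - move=> s /subset_itv_oo_cc/dab' ?.
    by rewrite derive1E; exact: DeriveDef.
  - exact: derivable_within_continuous.
  - by rewrite in_itv/= => sab ->; exists s.
have [h0|h0] := leP 0 h.
  rewrite !ger0_norm// in df *.
  have [||s sab ->] := H t (h + t); first by lra.
    by move=> s sab; apply: df; rewrite ler_norml; lra.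
  by exists s; [rewrite ler_norml; lra|congr (_ * _); lra].
rewrite !ltr0_norm// in df *.
have [||s sab E] := H (h + t) t; first by lra.
  by move=> s sab; apply: df; rewrite ler_norml; lra.
exists s; first by rewrite ler_norml; lra.
by rewrite -[LHS]opprB E -mulrN; congr (_ * _); lra.
Qed.

(** The partial derivatives of [v] are only known one variable at a time, so the
increment is split as (v (g s) s - v (g s) t) + (v (g s) t - v (g t) t).  The
second part is a composition of functions of one variable.  The mean value
theorem in time turns the first into (s - t) times the time derivative of [v] at
some point near (g t, t), and there continuity of that derivative suffices. *)
Lemma is_derive_along_curve {R : realType} (v : R -> R -> R) (g : R -> R)
    (t dg : R) :
  (\forall p \near (g t, t), derivable (v p.1) p.2 1) ->
  {for (g t, t), continuous (fun p : R * R => (v p.1)^`()%classic p.2)} ->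
  derivable (v^~ t) (g t) 1 -> is_derive t 1 g dg ->
  is_derive t 1 (fun s => v (g s) s)
    ((v (g t))^`()%classic t + (v^~ t)^`()%classic (g t) * dg).
Proof.
move=> dv cv dvx dgt.
have cg : {for t, continuous g}.
  by apply: differentiable_continuous; apply/derivable1_diffP; case: dgt.
have dxs : is_derive t 1 (fun s => v (g s) t) ((v^~ t)^`()%classic (g t) * dg).
  apply: (@is_derive1_comp _ (v^~ t) g).
  by rewrite derive1E; exact: DeriveDef.
have dts : is_derive t 1 (fun s => v (g s) s - v (g s) t)
    ((v (g t))^`()%classic t).
  suff H : h^-1 *: (((fun s => v (g s) s - v (g s) t) \o shift t) (h *: 1) -
      (v (g t) t - v (g t) t)) @[h --> 0^'] --> (v (g t))^`()%classic t.
    by apply: DeriveDef; [apply/cvg_ex; eexists; exact: H|exact/cvg_lim].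
  apply/cvgrPdist_le => /= e e0.
  have : \forall p \near (g t, t), derivable (v p.1) p.2 1 /\
      `|(v (g t))^`()%classic t - (v p.1)^`()%classic p.2| <= e.
    by near=> p; split; near: p => //; exact: (cvgr_dist_le _ _ cv).
  case=> -[A B] [/= nA nB] AB.
  have /nbhs_ballP[r /= r0 rB] := nB.
  near=> h.
  have hr : `|h| < r by near: h; exact: dnbhs0_lt.
  have h0 : h != 0 by near: h; exact: nbhs_dnbhs_neq.
  have Agh : A (g (h + t)).
    near: h; apply: (@cvg_within _ (nbhs 0)).
    have gt0 : (g \o shift t) 0 = g t by rewrite /= add0r.
    have : {for 0, continuous (g \o shift t)} by rewrite -continuous_shift.
    by rewrite /prop_for /continuous_at gt0; apply.
  have Bs s : `|s - t| <= `|h| -> B s.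
    by move=> sh; apply: rB; rewrite /ball/= distrC (le_lt_trans sh).
  have [s sh E] := @mean_value_near R (v (g (h + t))) t h
    (fun s sh => (AB (g (h + t), s) (conj Agh (Bs _ sh))).1).
  rewrite /= [h *: 1]mulr1 subrr subr0 E [_ *: _]mulrC mulfK//.
  exact: (AB (g (h + t), s) (conj Agh (Bs _ sh))).2.
rewrite (_ : (fun s => _) =
    (fun s => v (g s) s - v (g s) t) \+ (fun s => v (g s) t)).
  exact: is_deriveD.
by apply/funext => s /=; rewrite subrK.
Unshelve. all: by end_near. Qed.

(** The open domain is a neighbourhood of each of its points, so that [v] is
differentiable in time all around them, as [is_derive_along_curve] asks. *)
Lemma near_open_domain {R : realType} (l r : R -> R) (p : R * R) :
  {for p.2, continuous l} -> {for p.2, continuous r} ->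
  open_domain l r p -> \forall q \near p, open_domain l r q.
Proof.
move=> cl cr [p0 /andP[lp pr]].
have c2 : {for p, continuous (@snd R R)} by exact: cvg_snd.
have c1 : {for p, continuous (@fst R R)} by exact: cvg_fst.
have c0 : {for p, continuous (fun=> 0 : R)} by exact: cvg_cst.
have pos (f g : R * R -> R) : {for p, continuous f} -> {for p, continuous g} ->
    f p < g p -> \forall q \near p, f q < g q.
  move=> cf cg; rewrite -subr_gt0 => fg.
  have cgf : (fun q => g q - f q) q @[q --> p] --> g p - f p by exact: cvgB.
  by near=> q; rewrite -subr_gt0; near: q; exact: (cvgr_gt _ cgf).
near=> q; split; first by near: q; exact: (pos _ _ c0 c2).
apply/andP; split; near: q.
- apply: (pos (l \o snd) fst) => //; exact: continuous_comp c2 cl.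
- apply: (pos fst (r \o snd)) => //; exact: continuous_comp c2 cr.
Unshelve. all: by end_near. Qed.

(** * The change of frame *)

(** The change of variables for a single continuous path starting at 0.  The
extension of u_x to the lateral boundary is the one of v_chi, translated; the
boundary conditions of the two problems then differ by the sigma * w(t) that
separates u from v. *)
Lemma solves_S_of_solves_D {R : realType} (a b kappa eta nu sigma : R)
    (w f : R -> R) (a1 a2 b1 b2 c1 c2 d1 d2 : R) (g1 g2 g3 g4 : R -> R)
    (v : R -> R -> R) :
  w 0 = 0 -> {within [set t : R | 0 <= t], continuous w} ->
  solves_D a b kappa eta nu sigma w f a1 a2 b1 b2 c1 c2 d1 d2 g1 g2 g3 g4 v ->
  solves_S a b kappa eta nu sigma w f a1 a2 b1 b2 c1 c2 d1 d2 g1 g2 g3 g4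
    (fun x t : R =>
       v (x - sigma * \int[lebesgue_measure]_(s in `[0, t]) w s) t
       + sigma * w t).
Proof.
move=> w0 cw [[[dv cv] [dvt cvt]] cv0 eqv v0 [vx [vxE cvx] bc]].
pose c (t : R) := sigma * \int[lebesgue_measure]_(s in `[0, t]) w s.
set u := (fun x t : R => _ + _).
have cc : continuous c.
  by move=> t; apply: cvgM; [exact: cvg_cst|exact: continuous_primitive].
have cX x : continuous (frame sigma w x).
  by move=> t; apply: cvgB; [exact: cvg_cst|exact: cc].
pose phi (p : R * R) : R * R := (p.1 - c p.2, p.2).
have cphi : continuous phi.
  move=> p; apply: (@cvg_pair _ _ _ (nbhs p) (nbhs (p.1 - c p.2)) (nbhs p.2)
    _ _ _ (fun q => q.1 - c q.2) snd); last exact: cvg_snd.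
  apply: cvgB; first exact: cvg_fst.
  by apply: continuous_comp; [exact: cvg_snd|exact: cc].
have phi_open p : open_domain (fun=> a) (fun=> b) p ->
    open_domain (frame sigma w a) (frame sigma w b) (phi p).
  by rewrite /open_domain/= /frame -/(c _) !ltrD2r.
have phi_lateral p : lateral_domain (fun=> a) (fun=> b) p ->
    lateral_domain (frame sigma w a) (frame sigma w b) (phi p).
  by rewrite /lateral_domain/= /frame -/(c _) !lerD2r.
have phi_closed p : closed_domain (fun=> a) (fun=> b) p ->
    closed_domain (frame sigma w a) (frame sigma w b) (phi p).
  by rewrite /closed_domain/= /frame -/(c _) !lerD2r.
have dspaceS k x t : dspace k.+1 u x t = dspace k.+1 v (x - c t) t.
  by rewrite /dspace (derive1n_translate (v^~ t) (c t) (sigma * w t)).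
split.
- split=> [[|k] p k4 Dp|[|k] k4 p /set_mem Dp].
  + apply: (@derivable_translate _ (v^~ p.2)); exact: dv _ _ k4 (phi_open _ Dp).
  + rewrite (_ : (fun y => _) =
        (fun y => dspace k.+1 v (y - c p.2) p.2 + 0)); last first.
      by apply/funext => y; rewrite dspaceS addr0.
    apply: (@derivable_translate _ (fun y => dspace k.+1 v y p.2)).
    exact: dv _ _ k4 (phi_open _ Dp).
  + apply: cvgD; last first.
      apply: cvgM; first exact: cvg_cst.
      apply: (@continuous_comp _ _ _ snd w); first exact: cvg_snd.
      exact: path_continuous_at cw _ Dp.1.
    apply: (@continuous_comp _ _ _ phi (fun p => dspace 0 v p.1 p.2)).
      exact: cphi.
    by apply: cv => //; apply/mem_set/phi_open.
  + rewrite (_ : (fun p => _) = (fun p => dspace k.+1 v p.1 p.2) \o phi).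
      apply: (@continuous_comp _ _ _ phi (fun p => dspace k.+1 v p.1 p.2)).
        exact: cphi.
      by apply: cv => //; apply/mem_set/phi_open.
    by apply/funext => q; rewrite dspaceS.
- have cvphi := within_continuous_comp_into _ _ _ _ phi_closed
    (continuous_subspaceT cphi) cv0.
  have cwt : {within closed_domain (fun=> a) (fun=> b),
      continuous (w \o (snd : R * R -> R))}.
    apply: within_continuous_comp_into cw => [p []//|].
    by apply: continuous_subspaceT => p; exact: cvg_snd.
  move=> p; apply: cvgD; first exact: cvphi.
  by apply: cvgM; [exact: cvg_cst|exact: cwt].
- move=> x t xab t0.
  have Dp : open_domain (frame sigma w a) (frame sigma w b) (x - c t, t).
    exact: (phi_open (x, t)).
  have -> : (fun s => u x s - sigma * w s) = (fun s => v (x - c s) s).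
    by apply/funext => s; rewrite /u addrK.
  have dc : is_derive t 1 (fun s => x - c s) (- (sigma * w t)).
    have dI := is_derive_primitive w cw t t0.
    have dsI := is_deriveZ sigma dI.
    have := is_deriveB (is_derive_cst x t 1) dsI.
    by rewrite sub0r.
  apply: is_derive_eq.
    apply: (is_derive_along_curve v (fun s => x - c s)) dc.
    + near=> p; apply: dvt; near: p.
      exact: (near_open_domain _ _ (x - c t, t) (cX a t) (cX b t) Dp).
    + exact/cvt/mem_set.
    + exact: dv 0%N _ isT Dp.
  (* the transport term - sigma * w * v_chi completes v * v_chi to u * u_x *)
  rewrite eqv//; last by case: Dp.
  rewrite /gks_rhs !dspaceS /u -/(c t).
  rewrite -[(v^~ t)^`()%classic _]/(dspace 1 v (x - c t) t).
  move: (v _ t) (dspace 1 v _ t) (dspace 2 v _ t) (dspace 3 v _ t)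
    (dspace 4 v _ t) (w t) => V V1 V2 V3 V4 wt.
  ring.
- move=> x xab; rewrite /u set_itv1 Rintegral_set1 mulr0 subr0 w0 mulr0 addr0.
  by apply: v0; rewrite /frame set_itv1 Rintegral_set1 mulr0 !subr0.
- exists (fun x t => vx (x - c t) t).
    split=> [p Dp|]; first by rewrite dspaceS -(vxE (phi p))//; exact: phi_open.
    exact: (within_continuous_comp_into _ _ _ _ phi_lateral
      (continuous_subspaceT cphi) cvx).
  move=> t /bc[]; rewrite /frame -/(c t) /u -/(c t) => *.
  by split; lra.
Unshelve. all: by end_near. Qed.

Theorem theorem3 (R : realType) (d : measure_display) (T : measurableType d)
    (P : probability T R) (W : R -> {RV P >-> R}) (hW : brownian_motion W)
    (a b kappa eta nu sigma : R) (hab : a < b) (hkappa : 0 < kappa)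
    (f : R -> R) (a1 a2 b1 b2 c1 c2 d1 d2 : R)
    (g1 g2 g3 g4 : T -> R -> R) (v : T -> R -> R -> R) (w : T) :
  solves_D a b kappa eta nu sigma (fun t => W t w) f a1 a2 b1 b2 c1 c2 d1 d2
    (g1 w) (g2 w) (g3 w) (g4 w) (v w) ->
  solves_S a b kappa eta nu sigma (fun t => W t w) f a1 a2 b1 b2 c1 c2 d1 d2
    (g1 w) (g2 w) (g3 w) (g4 w)
    (fun x t : R =>
       v w (x - sigma * \int[lebesgue_measure]_(s in `[0, t]) W s w) t
       + sigma * W t w).
Proof. by case: hW => W0 cW _ _; exact: solves_S_of_solves_D. Qed.
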